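(* Let $v:2^V\to\mathbb{R}$ be a set function on a ground set $V$ with $|V|=n$, and let $$\alpha=\min_{j\in V,\ X\subset Y\subseteq V\setminus\{j\}}\big[v(j|X)-v(j|Y)\big].$$ If $\alpha$, or at least a lower bound on $\alpha$, can be computed in polynomial time, then submodular functions $f,g:2^V\to\mathbb{R}$ with $v(X)=f(X)-g(X)$ for all $X\subseteq V$ can be obtained in polynomial time.
   Context: A set function $f:2^V\to\mathbb{R}$ is submodular if $f(S)+f(T)\ge f(S\cup T)+f(S\cap T)$ for all $S,T\subseteq V$. Write $v(j|X)=v(X\cup\{j\})-v(X)$. The function $v$ is accessed through a value oracle; polynomial time means polynomial in $n$ (counting oracle calls and real arithmetic operations, including square roots, as single steps). ''Obtaining'' $f$ and $g$ means producing explicit descriptions from which $f(X)$ and $g(X)$ can be evaluated in polynomial time for any $X\subseteq V$, given the oracle for $v$. *)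

(* Defs.v *)
From HB Require Import structures.
From mathcomp Require Import all_boot all_order all_algebra.
From mathcomp Require Import reals constructive_ereal.

Set Implicit Arguments.
Unset Strict Implicit.
Unset Printing Implicit Defensive.
Import Order.TTheory GRing.Theory Num.Theory.
Local Open Scope ring_scope.

Definition submodular (R : realType) (V : finType) (f : {set V} -> R) : Prop :=
  forall S T : {set V}, f S + f T >= f (S :|: T) + f (S :&: T).

Definition marginal (R : realType) (V : finType) (v : {set V} -> R)
  (j : V) (X : {set V}) : R := v (X :|: [set j]) - v X.

(* The minimum is taken in \bar R because its range is empty when V has at   *)
(* most one element; alpha is then +oo. Otherwise it is a real number.       *)
Definition alpha (R : realType) (V : finType) (v : {set V} -> R) : \bar R :=
  \big[Order.min/+oo%E]_(t : V * {set V} * {set V} |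
      (t.1.2 \proper t.2) && (t.2 \subset ~: [set t.1.1]))
    (marginal v t.1.1 t.1.2 - marginal v t.1.1 t.2)%:E.

(* A real RAM with a value oracle. A program is a finite text, independent   *)
(* of n and of the oracle. Apart from copies and constants, index registers  *)
(* change by unit steps only, so that their contents stay polynomial in      *)
(* polynomial time. Real operations are total: x / 0 = 0, and the square     *)
(* root of x < 0 is 0.                                                       *)
(* In the constructors, i and j name index registers, r, r1 and r2 name real *)
(* registers, and a destination comes first.                                 *)
Inductive instr : Type :=
| IConst (i : nat) (k : nat)
| IMove (i j : nat)
| ISucc (i : nat)
| IPred (i : nat)
| RConst (r : nat) (k : int)
| ROfIndex (r i : nat)
| RMove (r r1 : nat)
| RAdd (r r1 r2 : nat)
| RSub (r r1 r2 : nat)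
| RMul (r r1 r2 : nat)
| RDiv (r r1 r2 : nat)
| RSqrt (r r1 : nat)
| ReadMem (r i : nat)
| WriteMem (i r : nat)
| SetBit (i : nat) (b : bool)
| Query (r : nat).

Inductive test : Type :=
| ILe (i j : nat)
| RLe (r1 r2 : nat)
| Bit (i : nat)
| Not (c : test).

Inductive prog : Type :=
| Instr (o : instr)
| Seq (P Q : prog)
| If (c : test) (P Q : prog)
| While (c : test) (P : prog).

(* idx: index registers; reg: real registers; mem: array of reals, addressed *)
(* through index registers; tape: oracle tape, also so addressed, holding    *)
(* the characteristic vector of a set.                                       *)
Record state (R : realType) : Type := State {
  idx : nat -> nat;
  reg : nat -> R;
  mem : nat -> R;
  tape : nat -> bool
}.

Definition tape_set (R : realType) (n : nat) (s : state R) : {set 'I_n} :=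
  [set i : 'I_n | tape s i].

Definition set_idx (R : realType) (s : state R) (i k : nat) : state R :=
  State [eta idx s with i |-> k] (reg s) (mem s) (tape s).

Definition set_reg (R : realType) (s : state R) (r : nat) (x : R) : state R :=
  State (idx s) [eta reg s with r |-> x] (mem s) (tape s).

Definition set_mem (R : realType) (s : state R) (a : nat) (x : R) : state R :=
  State (idx s) (reg s) [eta mem s with a |-> x] (tape s).

Definition set_tape (R : realType) (s : state R) (a : nat) (b : bool) :
  state R := State (idx s) (reg s) (mem s) [eta tape s with a |-> b].

Definition step (R : realType) (n : nat) (v : {set 'I_n} -> R) (o : instr)
  (s : state R) : state R :=
  match o with
  | IConst i k => set_idx s i k
  | IMove i j => set_idx s i (idx s j)
  | ISucc i => set_idx s i (idx s i).+1
  | IPred i => set_idx s i (idx s i).-1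
  | RConst r k => set_reg s r k%:~R
  | ROfIndex r i => set_reg s r (idx s i)%:R
  | RMove r r1 => set_reg s r (reg s r1)
  | RAdd r r1 r2 => set_reg s r (reg s r1 + reg s r2)
  | RSub r r1 r2 => set_reg s r (reg s r1 - reg s r2)
  | RMul r r1 r2 => set_reg s r (reg s r1 * reg s r2)
  | RDiv r r1 r2 => set_reg s r (reg s r1 / reg s r2)
  | RSqrt r r1 => set_reg s r (Num.sqrt (reg s r1))
  | ReadMem r i => set_reg s r (mem s (idx s i))
  | WriteMem i r => set_mem s (idx s i) (reg s r)
  | SetBit i b => set_tape s (idx s i) b
  | Query r => set_reg s r (v (tape_set n s))
  end.

Fixpoint holds (R : realType) (c : test) (s : state R) : bool :=
  match c with
  | ILe i j => (idx s i <= idx s j)%N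
  | RLe r1 r2 => reg s r1 <= reg s r2
  | Bit i => tape s (idx s i)
  | Not c' => ~~ holds c' s
  end.

(* exec v P s t s': with oracle v, P started in s halts in s' after t steps. *)
Inductive exec (R : realType) (n : nat) (v : {set 'I_n} -> R) :
  prog -> state R -> nat -> state R -> Prop :=
| ExecInstr o s : exec v (Instr o) s 1 (step v o s)
| ExecSeq P Q s1 s2 s3 t1 t2 :
    exec v P s1 t1 s2 -> exec v Q s2 t2 s3 ->
    exec v (Seq P Q) s1 (t1 + t2)%N s3
| ExecIf c P Q s s' t :
    exec v (if holds c s then P else Q) s t s' ->
    exec v (If c P Q) s t.+1 s'
| ExecWhileEnd c P s : ~~ holds c s -> exec v (While c P) s 1 s
| ExecWhile c P s1 s2 s3 t1 t2 :
    holds c s1 -> exec v P s1 t1 s2 -> exec v (While c P) s2 t2 s3 ->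
    exec v (While c P) s1 (t1 + t2).+1 s3.

(* Start state on a ground set of size n with input data d and input set X.  *)
Definition start (R : realType) (n : nat) (d : seq R) (X : {set 'I_n}) :
  state R :=
  State [eta fun=> 0%N with 0%N |-> n, 1%N |-> size d]
        (fun=> 0)
        (fun a => d`_a)
        (fun a => [exists i : 'I_n, (i == a :> nat) && (i \in X)]).

Definition halts_within (R : realType) (n : nat) (v : {set 'I_n} -> R)
  (P : prog) (d : seq R) (X : {set 'I_n}) (T : nat) (Q : state R -> Prop) :
  Prop :=
  exists t s, [/\ exec v P (start d X) t s, (t <= T)%N & Q s].

Definition out_real (R : realType) (s : state R) : R := reg s 0.

Definition out_seq (R : realType) (s : state R) : seq R :=
  mkseq (mem s) (idx s 0).

(* A class C of set functions, on ground sets of all finite sizes, is needed *)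
(* for "polynomial in n" to make sense: one program and one polynomial serve *)
(* all members of C, each accessed through its oracle only.                  *)
Definition set_function_class (R : realType) : Type :=
  forall n : nat, ({set 'I_n} -> R) -> Prop.

Definition computable_in_polytime (R : realType) (C : set_function_class R)
  (spec : forall n : nat, ({set 'I_n} -> R) -> R -> Prop) : Prop :=
  exists (P : prog) (p : {poly nat}), forall (n : nat) (v : {set 'I_n} -> R),
    C n v ->
    halts_within v P [::] set0 p.[n] (fun s => spec n v (out_real s)).

Definition alpha_computable (R : realType) (C : set_function_class R) : Prop :=
  computable_in_polytime C
    (fun (n : nat) (v : {set 'I_n} -> R) a => (1 < n)%N -> a%:E = alpha v).

Definition alpha_lower_bound_computable (R : realType)
  (C : set_function_class R) : Prop :=
  computable_in_polytime C
    (fun (n : nat) (v : {set 'I_n} -> R) a => (a%:E <= alpha v)%E).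

(* D writes a finite sequence of reals describing f and g; F and G evaluate  *)
(* f and g at any X from this description and the oracle for v.              *)
Definition submodular_difference_obtainable (R : realType)
  (C : set_function_class R) : Prop :=
  exists (D F G : prog) (p : {poly nat}),
    forall (n : nat) (v : {set 'I_n} -> R), C n v ->
    exists f g : {set 'I_n} -> R,
      [/\ submodular f, submodular g, forall X, v X = f X - g X &
          halts_within v D [::] set0 p.[n] (fun s =>
            forall X : {set 'I_n},
              halts_within v F (out_seq s) X p.[n] (fun s' => out_real s' = f X)
              /\
              halts_within v G (out_seq s) X p.[n]
                (fun s' => out_real s' = g X))].

(* Main.v *)
Require Import Defs.
From mathcomp Require Import all_boot all_order all_algebra.
From mathcomp Require Import reals constructive_ereal.
From mathcomp Require Import ring lra zify.

(* If a is a lower bound on alpha and c = |a|, then g X = - c |X|^2 is         *)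
(* submodular, and f = v + g is too: for X properly contained in Y, passing    *)
(* from X to Y lowers the marginals of g by 2 c (|Y| - |X|) >= 2 c, which      *)
(* outweighs an increase of those of v by at most - a. The number a is all     *)
(* the description that f and g need.                                          *)

Set Implicit Arguments.
Unset Strict Implicit.
Unset Printing Implicit Defensive.
Import Order.TTheory GRing.Theory Num.Theory.
Local Open Scope ring_scope.

(** Submodularity is reduced to decreasing marginals ([submodular_of_marginal]);
    [submodular_sub_card_sqr] then serves both f and g. On the machine side, [exec_penalty_prog]
    evaluates the common penalty in linear time from the one stored real. *)

(** Add the elements of [A] one at a time and telescope; disjointness from [Y] keeps each added
    element new. *)
Lemma marginal_set_antitone (R : realType) (V : finType) (f : {set V} -> R) :
  (forall (j : V) (X Y : {set V}), X \subset Y -> j \notin Y ->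
     marginal f j Y <= marginal f j X) ->
  forall A X Y : {set V}, X \subset Y -> [disjoint A & Y] ->
    f (Y :|: A) - f Y <= f (X :|: A) - f X.
Proof.
move=> fP A; have [k] := ubnP #|A|.
elim: k A => // k IHk A Ak X Y sXY dAY.
have [->|[j Aj]] := set_0Vmem A; first by rewrite !setU0 !subrr.
have eA Z : Z :|: A = (Z :|: A :\ j) :|: [set j].
  by rewrite -setUA (setUC _ [set j]) setD1K.
have dA'Y : [disjoint A :\ j & Y] by apply: disjointWl dAY; apply: subsetDl.
have jY : j \notin Y :|: A :\ j by rewrite !inE eqxx orbF (disjointFr dAY).
have := IHk (A :\ j) _ X Y sXY dA'Y.
rewrite (cardsD1 j) Aj add1n ltnS in Ak => /(_ Ak).
have := fP j _ _ (setSU (A :\ j) sXY) jY.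
rewrite /marginal !eA; lra.
Qed.

Lemma submodular_of_marginal (R : realType) (V : finType) (f : {set V} -> R) :
  (forall (j : V) (X Y : {set V}), X \subset Y -> j \notin Y ->
     marginal f j Y <= marginal f j X) ->
  submodular f.
Proof.
move=> fP S T.
(* Adding [S :\: T] to [S :&: T] gives [S]; adding it to [T] gives [S :|: T]. *)
have dST : [disjoint S :\: T & T] by rewrite disjoints_subset setDE subsetIr.
have := marginal_set_antitone fP (subsetIr S T) dST.
rewrite setID setDE setUIr setUCr setIT (setUC T); lra.
Qed.

Lemma submodular_sub_card_sqr (R : realType) (V : finType) (v : {set V} -> R)
    (c : R) : 0 <= c ->
  (forall (j : V) (X Y : {set V}), X \proper Y -> j \notin Y ->
     - (2 * c) <= marginal v j X - marginal v j Y) ->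
  submodular (fun X => v X - c * #|X|%:R ^+ 2).
Proof.
move=> c0 vP; apply: submodular_of_marginal => j X Y sXY jY.
have [->//|nXY] := eqVneq X Y.
have pXY : X \proper Y by rewrite properEneq nXY.
have jX : j \notin X by apply: contra jY; apply: (subsetP sXY).
have := vP j X Y pXY jY.
have cXY : #|X|%:R + 1 <= #|Y|%:R :> R by rewrite natr1 ler_nat proper_card.
(* For j outside X, the marginal of c |X|^2 is c (2 |X| + 1). *)
rewrite /marginal !(setUC _ [set j]) !cardsU1 jX jY !natrD /=.
have := ler_wpM2l c0 cXY; lra.
Qed.

Lemma marginal_lower_bound (R : realType) (V : finType) (v : {set V} -> R)
    (a : R) : (a%:E <= alpha v)%E ->
  forall (j : V) (X Y : {set V}), X \proper Y -> j \notin Y ->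
    a <= marginal v j X - marginal v j Y.
Proof.
move=> av j X Y XY jY; rewrite -lee_fin; apply: le_trans av _.
by apply: (bigmin_le_cond _ (j := (j, X, Y))); rewrite /= XY subsetC sub1set inE.
Qed.

Lemma alpha_card_le1 (R : realType) (V : finType) (v : {set V} -> R) :
  (#|V| <= 1)%N -> alpha v = +oo%E.
Proof.
move=> V1; rewrite /alpha big_pred0 // => -[[j X] Y] /=.
apply/negP => /andP[/properP[_ [k kY _]]]; rewrite subsetC sub1set inE => /negP[].
by have /card_le1P := V1; move=> /(_ k isT j); rewrite !inE => /esym/eqP->.
Qed.

(** The same program works: for n at most 1 its output is unconstrained, but alpha is then +oo, so
    any real is a lower bound. *)
Lemma alpha_computable_lower_bound (R : realType) (C : set_function_class R) :
  alpha_computable C -> alpha_lower_bound_computable C.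
Proof.
move=> [P [p Pp]]; exists P, p => n v /Pp[t [s [e tp a_alpha]]].
exists t, s; split=> //; have [n1|n1] := ltnP 1 n; first by rewrite a_alpha.
by rewrite alpha_card_le1 ?card_ord ?leey.
Qed.

(* Index registers: 0 holds n, 2 runs over the tape, 3 counts the elements;   *)
(* 4 stays 0, the address of a in the description. IMove 2 2 does nothing.     *)
Definition count_body : prog :=
  Seq (If (Bit 2) (Instr (ISucc 3)) (Instr (IMove 2 2))) (Instr (ISucc 2)).

Definition count_loop : prog := While (Not (ILe 0 2)) count_body.

(** The start state is arbitrary so that induction on the remaining tape applies. A round costs one
    test plus three body steps; the final 1 is the failing test. *)
Lemma exec_count_loop (R : realType) (n : nat) (v : {set 'I_n} -> R)
    (s : state R) : exists t s',
  [/\ exec v count_loop s t s', (t <= 4 * (idx s 0 - idx s 2) + 1)%N,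
      [/\ reg s' = reg s, Defs.mem s' = Defs.mem s & tape s' = tape s],
      idx s' 4 = idx s 4 &
      idx s' 3 = (idx s 3 + \sum_(idx s 2 <= k < idx s 0) tape s k)%N].
Proof.
have [m] := ubnP (idx s 0 - idx s 2); elim: m s => // m IHm s sm.
have [le02|lt20] := leqP (idx s 0) (idx s 2).
  exists 1%N, s; split=> //; first by apply: ExecWhileEnd; rewrite /= negbK.
    by rewrite addn1.
  by rewrite big_geq ?addn0.
pose s1 := if tape s (idx s 2) then set_idx s 3 (idx s 3).+1
           else set_idx s 2 (idx s 2).
pose s2 := set_idx s1 2 (idx s1 2).+1.
have body : exec v count_body s 3 s2.
  apply: (@ExecSeq _ _ _ _ _ _ s1 _ 2 1); last exact: ExecInstr.
  apply: ExecIf; rewrite /= /s1; case: ifP => _; exact: ExecInstr.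
have [i20 i22 i24] :
    [/\ idx s2 0 = idx s 0, idx s2 2 = (idx s 2).+1 & idx s2 4 = idx s 4].
  by rewrite /s2 /s1; case: ifP.
have i23 : idx s2 3 = (idx s 3 + tape s (idx s 2))%N.
  by rewrite /s2 /s1; case: ifP; rewrite /= ?addn1 ?addn0.
have [r2 m2 t2] : [/\ reg s2 = reg s, Defs.mem s2 = Defs.mem s & tape s2 = tape s].
  by rewrite /s2 /s1; case: ifP.
have [|t [s' [e tle [r' m' t'] i4 i3]]] := IHm s2; first by rewrite i20 i22; lia.
exists (3 + t).+1, s'; split.
- by apply: ExecWhile body e; rewrite /= -ltnNge.
- by move: tle; rewrite i20 i22; lia.
- by rewrite r' m' t'.
- by rewrite i4.
- by rewrite i3 i20 i22 i23 t2 -addnA -big_ltn.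
Qed.

(** The absolute value is obtained as sqrt (a * a). Real register 0 is left at 0, ready for
    evaluating g. *)
Definition penalty_prog : prog :=
  Seq count_loop
    (Seq (Instr (ReadMem 1 4))
    (Seq (Instr (RMul 1 1 1))
    (Seq (Instr (RSqrt 1 1))
    (Seq (Instr (ROfIndex 2 3))
    (Seq (Instr (RMul 2 2 2))
         (Instr (RMul 1 1 2))))))).

Lemma tape_set_start (R : realType) (n : nat) (d : seq R) (X : {set 'I_n}) :
  tape_set n (start d X) = X.
Proof.
apply/setP => i; rewrite inE /=; apply/existsP/idP => [[k]|Xi].
  by case/andP=> /eqP/val_inj->.
by exists i; rewrite eqxx.
Qed.

Lemma exec_penalty_prog (R : realType) (n : nat) (v : {set 'I_n} -> R) (a : R)
    (X : {set 'I_n}) : exists t s,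
  [/\ exec v penalty_prog (start [:: a] X) t s, (t <= 4 * n + 7)%N,
      tape_set n s = X, reg s 0 = 0 & reg s 1 = `|a| * #|X|%:R ^+ 2].
Proof.
have [t [s [e tle [rs ms ts] i4 i3]]] := exec_count_loop v (start [:: a] X).
exists (t + 6)%N; eexists; split.
- apply: ExecSeq e _.
  do 5!apply: (@ExecSeq _ _ _ _ _ _ _ _ 1 _ (ExecInstr _ _ _)).
  exact: ExecInstr.
- by move: tle; rewrite /= subn0; lia.
- by rewrite /tape_set /= ts; apply: tape_set_start.
- by rewrite /= rs.
- rewrite /= ms i4 i3 /= add0n -expr2 sqrtr_sqr -expr2 big_mkord.
  rewrite -sum1_card [in RHS]big_mkcond /=; congr (_ * _%:R ^+ 2).
  apply: eq_bigr => i _; have /setP/(_ i) := tape_set_start [:: a] X.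
  by rewrite inE /= => ->; case: (i \in X).
Qed.

Theorem lemma3p2 (R : realType) (C : set_function_class R) :
  alpha_computable C \/ alpha_lower_bound_computable C ->
  submodular_difference_obtainable C.
Proof.
move=> H; have {H} [P [p Pp]] : alpha_lower_bound_computable C.
  by case: H => // /alpha_computable_lower_bound.
(* The output a of [P] goes to address 0; index register 0 then holds the description's length 1. *)
exists (Seq P (Seq (Instr (IConst 0 0)) (Seq (Instr (WriteMem 0 0))
         (Instr (IConst 0 1))))).
exists (Seq penalty_prog (Seq (Instr (Query 0)) (Instr (RSub 0 0 1)))).
exists (Seq penalty_prog (Instr (RSub 0 0 1))).
(* [p] pays for [P]; 4 n + 9 is the penalty's 4 n + 7 plus the two last instructions for f. *)
exists (p + 4%N *: 'X + 9%N%:P) => n v /Pp[t [s [eP tp av]]].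
have -> : (p + 4%N *: 'X + 9%N%:P).[n] = (p.[n] + (4 * n + 9))%N.
  by rewrite !hornerD hornerZ hornerX hornerC; apply: esym; apply: addnA.
set a := out_real s in av.
exists (fun X : {set 'I_n} => v X - `|a| * #|X|%:R ^+ 2).
(* The leading 0 makes g an instance of the lemma used for f, with the zero function for v. *)
exists (fun X : {set 'I_n} => 0 - `|a| * #|X|%:R ^+ 2).
split.
- apply: submodular_sub_card_sqr => // j X Y XY jY.
  apply: le_trans (marginal_lower_bound av XY jY).
  have := lerNnormlW (lexx `|a|); have := normr_ge0 a; lra.
- apply: submodular_sub_card_sqr => // j X Y _ _.
  by rewrite /marginal !subrr oppr_le0 mulr_ge0.
- by move=> X; ring.
- exists (t + 3)%N; eexists; split; [|lia|].
    apply: ExecSeq eP _.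
    do 2!apply: (@ExecSeq _ _ _ _ _ _ _ _ 1 _ (ExecInstr _ _ _)).
    exact: ExecInstr.
  move=> X; rewrite /out_seq /mkseq /= -/(out_real s) -/a.
  have [t' [s' [e tle ts r0 r1]]] := exec_penalty_prog v a X.
  split.
    exists (t' + 2)%N; eexists; split; [|lia|].
      apply: ExecSeq e _; apply: (@ExecSeq _ _ _ _ _ _ _ _ 1 1); exact: ExecInstr.
    by rewrite /out_real /= r1 ts.
  exists (t' + 1)%N; eexists; split; [|lia|].
    by apply: ExecSeq e _; exact: ExecInstr.
  by rewrite /out_real /= r0 r1.
Qed.
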